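(* Let $(X,d)$ be a compact metric space and let $f\in Hom(X)$ be such that $\mathcal{GR}(f)\neq X$. If $\mathcal{GR}(f)=\mathcal{CR}(f)$, then $f$ does not permit $\mathcal{GR}$-explosions.
   Context: $Hom(X)$ is the space of homeomorphisms of $X$ with the uniform topology induced by $d_{\mathscr{C}^0}(f,g)=\max_{x\in X}d(f(x),g(x))$. Chain recurrence: given $x,y\in X$ and $\varepsilon>0$, an $\varepsilon$-chain for $f$ from $x$ to $y$ is a finite sequence $(x_i)_{i=1}^n$ ($n\ge1$) in $X$ with $x_1=x$ and, setting $x_{n+1}=y$, $d(f(x_i),x_{i+1})<\varepsilon$ for all $i=1,\dots,n$. $\mathcal{CR}(f)$ is the set of $x\in X$ such that for every $\varepsilon>0$ there is an $\varepsilon$-chain from $x$ to $x$. Strong chain recurrence: a strong $\varepsilon$-chain from $x$ to $y$ (for the metric $d$) is a finite sequence $(x_i)_{i=1}^n$ ($n\ge1$) in $X$ with $x_1=x$ and, setting $x_{n+1}=y$, $\sum_{i=1}^n d(f(x_i),x_{i+1})<\varepsilon$. $\mathcal{SCR}_d(f)$ is the set of $x\in X$ such that for every $\varepsilon>0$ there is a strong $\varepsilon$-chain from $x$ to $x$. The generalized recurrent set is $\mathcal{GR}(f)=\bigcap_{d'}\mathcal{SCR}_{d'}(f)$, the intersection being over all metrics $d'$ compatible with the topology of $X$. For $f\in Hom(X)$ with $\mathcal{GR}(f)\neq X$, $f$ does not permit $\mathcal{GR}$-explosions if for any open neighborhood $U$ of $\mathcal{GR}(f)$ in $X$ there exists a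 neighborhood $V$ of $f$ in $Hom(X)$ such that if $g\in V$ then $\mathcal{GR}(g)\subset U$. *)

(* Defs.v *)
From HB Require Import structures.
From mathcomp Require Import all_boot all_order all_algebra.
From mathcomp Require Import all_classical all_reals all_analysis.
From mathcomp Require Import lra.
Set Implicit Arguments.
Unset Strict Implicit.
Unset Printing Implicit Defensive.
Import Order.TTheory GRing.Theory Num.Theory.
Import numFieldNormedType.Exports.
Local Open Scope classical_set_scope.
Local Open Scope ring_scope.

Definition homeomorphism (X : topologicalType) (f : X -> X) : Prop :=
  continuous f /\ exists g : X -> X, [/\ continuous g, cancel f g & cancel g f].

(* The compactness proof is a parameter so that the C^0 distance below is
   finite and Homeo carries a canonical metric structure. *)
Record Homeo (R : realType) (X : metricType R) (cX : compact [set: X]) := MkHomeo {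
  Homeo_fun :> X -> X ;
  Homeo_homeo : homeomorphism Homeo_fun }.

HB.instance Definition _ (R : realType) (X : metricType R)
  (cX : compact [set: X]) := gen_eqMixin (Homeo cX).
HB.instance Definition _ (R : realType) (X : metricType R)
  (cX : compact [set: X]) := gen_choiceMixin (Homeo cX).

(* For f, g continuous on a nonempty compact X the supremum is attained, see
   dC0_max; on an empty X it is 0. *)
Definition dC0 (R : realType) (X : metricType R) (f g : X -> X) : R :=
  sup [set mdist (f x) (g x) | x in [set: X]].

Section Homeo_metric.
Context {R : realType} {X : metricType R} (cX : compact [set: X]).
Implicit Types f g h : Homeo cX.

Lemma continuous_mdist (f g : X -> X) : continuous f -> continuous g ->
  continuous (fun x => mdist (f x) (g x) : R).
Proof.
move=> cf cg x; apply/cvgrPdist_lt => e e0.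
have e20 : 0 < e / 2 by rewrite divr_gt0.
have hf := metricType_numDomainType.cvgr_dist_lt (cf x) e20.
have hg := metricType_numDomainType.cvgr_dist_lt (cg x) e20.
near=> y.
have fy : mdist (f x) (f y) < e / 2 by near: y; exact: hf.
have gy : mdist (g x) (g y) < e / 2 by near: y; exact: hg.
have t1 := metric_triangle (f x) (f y) (g x).
have t2 := metric_triangle (f y) (g y) (g x).
have t3 := metric_triangle (f y) (f x) (g y).
have t4 := metric_triangle (f x) (g x) (g y).
rewrite (metric_sym (g y) (g x)) in t2; rewrite (metric_sym (f y) (f x)) in t3.
move: fy gy t1 t2 t3 t4.
move: (mdist (f x) (g x)) (mdist (f y) (g y)) (mdist (f x) (f y))
  (mdist (g x) (g y)) (mdist (f y) (g x)) (mdist (f x) (g y)) => a b c d u v.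
by move=> *; rewrite ltr_norml; apply/andP; split; lra.
Unshelve. all: by end_near. Qed.

Lemma dC0_max f g : [set: X] !=set0 ->
  exists2 x, dC0 f g = mdist (f x) (g x) &
             forall y, mdist (f y) (g y) <= mdist (f x) (g x).
Proof.
move=> X0; have c : {within [set: X], continuous (fun x => mdist (f x) (g x) : R)}.
  apply: continuous_subspaceT.
  by apply: continuous_mdist; [case: (Homeo_homeo f) | case: (Homeo_homeo g)].
have [x _ xmax] := compact_EVT_max X0 cX c.
have {}xmax y : mdist (f y) (g y) <= mdist (f x) (g x) by apply: xmax; rewrite inE.
exists x => //; apply/eqP; rewrite eq_le; apply/andP; split.
  by apply: ge_sup => [|_ [y _ <-]//]; exists (mdist (f x) (g x)), x.
apply: ub_le_sup; last by exists x.
by exists (mdist (f x) (g x)) => _ [y _ <-].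
Qed.

Lemma le_dC0 f g x : mdist (f x) (g x) <= dC0 f g.
Proof. by have [|y -> ->//] := dC0_max f g; exists x. Qed.

Lemma dC0_empty f g : ~ ([set: X] !=set0) -> dC0 f g = 0.
Proof.
move=> X0; rewrite /dC0 (_ : [set _ | _ in _] = set0) ?sup0//.
by apply/seteqP; split => [y [x _ _]|y []]; apply: X0; exists x.
Qed.

Lemma dC0_le f g (e : R) :
  0 <= e -> (forall x, mdist (f x) (g x) <= e) -> dC0 f g <= e.
Proof.
move=> e0 H; have [/(dC0_max f g)[x -> _]//|/dC0_empty ->//] :=
  pselect ([set: X] !=set0).
Qed.

Lemma dC0_ge0 f g : 0 <= dC0 f g.
Proof.
have [/(dC0_max f g)[x -> _]|/dC0_empty ->//] := pselect ([set: X] !=set0).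
exact: mdist_ge0.
Qed.

Lemma dC0xx f : dC0 f f = 0.
Proof.
apply/eqP; rewrite eq_le dC0_ge0 andbT.
by apply: dC0_le => // x; rewrite mdistxx.
Qed.

Lemma dC0_eq0 f g : dC0 f g = 0 -> f = g.
Proof.
move=> fg0; have fg : Homeo_fun f = Homeo_fun g.
  apply/funext => x; apply: (@mdist_positivity R X); apply/eqP.
  by rewrite eq_le mdist_ge0 andbT -fg0 le_dC0.
clear fg0; case: f fg => f fP; case: g => g gP /= fg; subst g.
by congr MkHomeo; exact: Prop_irrelevance.
Qed.

Lemma dC0_sym f g : dC0 f g = dC0 g f.
Proof.
rewrite /dC0; congr sup; apply/seteqP.
by split=> _ [x _ <-]; exists x => //; rewrite metric_sym.
Qed.

Lemma dC0_triangle g f h : dC0 f h <= dC0 f g + dC0 g h.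
Proof.
apply: dC0_le => [|x]; first by rewrite addr_ge0 ?dC0_ge0.
by rewrite (le_trans (metric_triangle _ (g x) _))// lerD ?le_dC0.
Qed.

HB.instance Definition _ := @isMetric.Build R (Homeo cX)
  (fun f g => dC0 f g) dC0xx dC0_eq0 dC0_sym dC0_triangle.

Lemma Homeo_mdistE f g : mdist f g = dC0 f g. Proof. by []. Qed.

End Homeo_metric.

(* An eps-chain (x_1, ..., x_n) with x_{n+1} = y is encoded by the first n.+1
   values of u : nat -> X, shifted by one: x_{i+1} = u i. *)
Definition eps_chain (R : realType) (X : metricType R) (f : X -> X) (e : R)
    (x y : X) : Prop :=
  exists (n : nat) (u : nat -> X), [/\ (0 < n)%N, u 0%N = x, u n = y &
    forall i, (i < n)%N -> mdist (f (u i)) (u i.+1) < e].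

Definition CR (R : realType) (X : metricType R) (f : X -> X) : set X :=
  [set x | forall e : R, 0 < e -> eps_chain f e x x].

Definition strong_eps_chain (R : realType) (X : Type) (d : X -> X -> R)
    (f : X -> X) (e : R) (x y : X) : Prop :=
  exists (n : nat) (u : nat -> X), [/\ (0 < n)%N, u 0%N = x, u n = y &
    \sum_(i < n) d (f (u i)) (u i.+1) < e].

Definition SCR (R : realType) (X : Type) (d : X -> X -> R) (f : X -> X)
    : set X :=
  [set x | forall e : R, 0 < e -> strong_eps_chain d f e x x].

Definition is_metric (R : realType) (X : Type) (d : X -> X -> R) : Prop :=
  [/\ forall x y, 0 <= d x y,
      forall x y, d x y = 0 <-> x = y,
      forall x y, d x y = d y x &
      forall x y z, d x z <= d x y + d y z].

Definition compatible_metric (R : realType) (X : topologicalType)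
    (d : X -> X -> R) : Prop :=
  is_metric d /\
  forall (x : X) (A : set X),
    nbhs x A <-> exists2 e : R, 0 < e & [set y | d x y < e] `<=` A.

Lemma compatible_mdist (R : realType) (X : metricType R) :
  compatible_metric (@mdist R X).
Proof.
split=> [|x A]; first split.
- exact: mdist_ge0.
- by move=> x y; split=> [|->]; [exact: mdist_positivity|exact: mdistxx].
- exact: metric_sym.
- exact: metric_triangle.
- by rewrite -metricType_numDomainType.nbhs_nbhs_mdist.
Qed.

Definition GR (R : realType) (X : metricType R) (f : X -> X) : set X :=
  \bigcap_(d in [set d : X -> X -> R | compatible_metric d]) SCR d f.

Definition no_GR_explosions (R : realType) (X : metricType R)
    (cX : compact [set: X]) (f : Homeo cX) : Prop :=
  forall U : set X, open U -> GR f `<=` U ->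
    exists2 V : set (Homeo cX), nbhs f V & forall g, V g -> GR g `<=` U.

(* Main.v *)
(** Chain recurrence is robust: if [x] is not chain recurrent for [f], then no
[y] near [x] is chain recurrent for any [g] near [f], because a fine [g]-chain
from [y] to [y] becomes an [f]-chain from [x] to [x] when its ends are moved to
[x]. Compactness of the complement of [U] makes this uniform, so [CR g] lies in
[U] for [g] near [f] as soon as [CR f] does; and [GR g] is contained in [CR g]. *)
Require Import Defs.
From mathcomp Require Import all_boot all_order all_algebra.
From mathcomp Require Import all_classical all_reals all_analysis.
From mathcomp Require Import lra.
Import Order.TTheory GRing.Theory Num.Theory.
Local Open Scope classical_set_scope.
Local Open Scope ring_scope.

(** Each jump of a strong chain is one term of a sum of nonnegative terms, hence at most the whole
    sum. *)
Lemma SCR_sub_CR (R : realType) (X : metricType R) (f : X -> X) :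
  SCR (@mdist R X) f `<=` CR f.
Proof.
move=> x xS e e0; have [n [u [n0 u0 un ue]]] := xS e e0.
exists n, u; split=> // i i_n; apply: le_lt_trans ue.
rewrite (bigD1 (Ordinal i_n))//= lerDl.
by apply: sumr_ge0 => j _; exact: mdist_ge0.
Qed.

Lemma GR_sub_CR (R : realType) (X : metricType R) (f : X -> X) :
  GR f `<=` CR f.
Proof. by move=> x xG; apply/SCR_sub_CR/xG; exact: compatible_mdist. Qed.

(** Four errors below [e / 4] add up in each jump: moving its start (seen through [f]), replacing
    [f] by [g], the jump of the [g]-chain, and moving its end. *)
Lemma eps_chain_perturb (R : realType) (X : metricType R) (f g : X -> X)
    (e : R) (x y : X) :
  (forall z, mdist (f z) (g z) < e / 4) ->
  mdist x y < e / 4 -> mdist (f x) (f y) < e / 4 ->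
  eps_chain g (e / 4) y y -> eps_chain f e x x.
Proof.
move=> fg xy fxy [n [u [n0 u0 un ue]]].
have e0 : 0 < e by have := le_lt_trans (mdist_ge0 x y) xy; lra.
(* Both ends become [x]; when [n = 1] they bound the same jump, which the four-error count still
   covers. *)
pose v i := if (i == 0%N) || (i == n) then x else u i.
have uv i : mdist (v i) (u i) < e / 4 /\ mdist (f (v i)) (f (u i)) < e / 4.
  rewrite /v; case: ifPn => [/orP[] /eqP ->|_]; rewrite ?u0 ?un//.
  by rewrite !mdistxx; split; lra.
exists n, v; split=> //; first by rewrite /v eqxx orbT.
move=> i i_n; have [_ fi] := uv i; have [vi _] := uv i.+1.
have gi := fg (u i); have ui := ue i i_n.
have t1 := metric_triangle (f (v i)) (f (u i)) (v i.+1).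
have t2 := metric_triangle (f (u i)) (g (u i)) (v i.+1).
have t3 := metric_triangle (g (u i)) (u i.+1) (v i.+1).
rewrite (metric_sym (u i.+1)) in t3.
lra.
Qed.

(** Joint nearness in [y] and [g] is what the near-covering form of compactness takes as input. *)
Lemma near_not_CR (R : realType) (X : metricType R) (cX : compact [set: X])
    (f : Homeo cX) (x : X) :
  ~ CR f x -> \forall y \near x & g \near f, ~ CR (g : Homeo cX) y.
Proof.
move=> /existsNP[e /not_implyP[e0 nchain]].
have e40 : 0 < e / 4 by lra.
have [cf _] := Homeo_homeo f.
have near_x : \forall y \near x, mdist x y < e / 4 /\ mdist (f x) (f y) < e / 4.
  apply: filterI.
    exact: (metricType_numDomainType.cvgr_dist_lt (f := id) cvg_id e40).
  exact: (metricType_numDomainType.cvgr_dist_lt (cf x) e40).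
have near_f : \forall g \near f, mdist f g < e / 4.
  exact: (metricType_numDomainType.cvgr_dist_lt (f := id) cvg_id e40).
near=> y g => /(_ _ e40) chain; apply: nchain.
have [xy fxy] : mdist x y < e / 4 /\ mdist (f x) (f y) < e / 4.
  by near: y.
have fg : mdist f g < e / 4 by near: g.
apply: (eps_chain_perturb _ _ _ _ _ _ _ _ xy fxy chain) => z.
exact: le_lt_trans (le_dC0 f g z) fg.
Unshelve. all: by end_near. Qed.

Local Close Scope ring_scope.

Theorem corollary3p1 (R : realType) (X : metricType R)
    (cX : compact [set: X]) (f : Homeo cX) :
  GR f <> [set: X] -> GR f = CR f -> no_GR_explosions f.
Proof.
move=> _ GRCR U oU GRU; exists [set g : Homeo cX | CR g `<=` U]; last first.
  by move=> g gU; exact: subset_trans (GR_sub_CR _ _ _) gU.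
have /compact_near_coveringP covU : compact (~` U).
  exact: (subclosed_compact (open_closedC oU) cX).
(* Points outside [U] avoid [GR f = CR f]; compactness merges their local neighborhoods of [f] into
   one. *)
have : \forall g \near f, ~` U `<=` (fun y => ~ CR (g : Homeo cX) y).
  apply: (covU _ (nbhs f) (fun (g : Homeo cX) y => ~ CR g y)) => x nUx.
  by apply: near_not_CR; rewrite -GRCR => /GRU.
by apply: filterS => g gU y yCR; apply: contrapT => /gU.
Qed.
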